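(* Let $\Bbbk$ be a field of characteristic $0$. For every $n\ge3$, let $C_n$ be the cycle graph with vertex set $[n]=\{1,\dots,n\}$ and edges $\{i,i+1\}$ for $1\le i\le n-1$ together with $\{n,1\}$. Then $A_{\mathrm c}(C_n)$ has the weak Lefschetz property (WLP) if and only if $n$ is odd.
   Context: A vertex cover of a graph $G$ is a set of vertices meeting every edge. For a finite simple graph $G$ on $[n]$, let $R=\Bbbk[x_1,\dots,x_n]$ with the standard grading, $x_C=\prod_{i\in C}x_i$, $J(G)=(x_C : C\text{ a vertex cover of }G)\subset R$, and $A_{\mathrm c}(G)=R/\big((x_1^2,\dots,x_n^2)+J(G)\big)$. A standard graded Artinian $\Bbbk$-algebra $A=\bigoplus_i[A]_i$ has the WLP if there is a linear form $\ell\in[A]_1$ such that for every $i$ the multiplication map $\cdot\ell:[A]_i\to[A]_{i+1}$ is injective or surjective. *)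

(* Defs.v *)
From HB Require Import structures.
From mathcomp Require Import all_boot all_order all_algebra.
From mathcomp Require Import boolp classical_sets functions.
From mathcomp Require Import mpoly.

Set Implicit Arguments.
Unset Strict Implicit.
Unset Printing Implicit Defensive.

Import GRing.Theory.
Local Open Scope ring_scope.
Local Open Scope quotient_scope.
Local Open Scope classical_set_scope.

Record sgraph (n : nat) := SGraph {
  adj : rel 'I_n;
  adj_sym : ssrbool.symmetric adj;
  adj_irr : irreflexive adj
}.

Definition vertex_cover n (G : sgraph n) (C : {set 'I_n}) : Prop :=
  forall i j : 'I_n, adj G i j -> (i \in C) || (j \in C).

(* Vertices are numbered from 0, and ordS i is the successor of i modulo n.
   The conjunct i != j only matters for n = 1. *)
Definition cycle_adj n : rel 'I_n :=
  [rel i j | (i != j) && ((j == ordS i) || (i == ordS j))].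

Lemma cycle_adj_sym n : ssrbool.symmetric (@cycle_adj n).
Proof. by move=> i j; rewrite /cycle_adj /= eq_sym orbC. Qed.

Lemma cycle_adj_irr n : irreflexive (@cycle_adj n).
Proof. by move=> i; rewrite /cycle_adj /= eqxx. Qed.

Definition cycle_graph n : sgraph n :=
  SGraph (@cycle_adj_sym n) (@cycle_adj_irr n).

Definition is_ideal (R : comNzRingType) (I : set R) : Prop :=
  I 0 /\ forall a u v, I u -> I v -> I (a * u + v).

(* The ideals of ring_quotient are proper, whereas J(G) is the unit ideal
   when G has no edge; hence ideals are defined here without that condition. *)
Record ideal (R : comNzRingType) := Ideal {
  ideal_set :> set R;
  ideal_setP : is_ideal ideal_set
}.

Section Ideals.
Variable R : comNzRingType.
Implicit Types (S : set R) (I J : ideal R).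

Lemma is_ideal_smallest S : is_ideal (smallest (@is_ideal R) S).
Proof.
split=> [I [[I0 _] _]|a u v Iu Iv I [II SI]]; first exact: I0.
by apply: II.2; [apply: Iu | apply: Iv].
Qed.

Definition ideal_gen S : ideal R := Ideal (is_ideal_smallest S).

Lemma is_ideal_add I J : is_ideal [set u + v | u in I & v in J].
Proof.
have [[I0 IP] [J0 JP]] := (ideal_setP I, ideal_setP J).
split; first by exists 0 => //; exists 0 => //; rewrite addr0.
move=> a _ _ [u Iu [v Jv <-]] [u' Iu' [v' Jv' <-]].
exists (a * u + u'); first exact: IP.
by exists (a * v + v'); [exact: JP | rewrite mulrDr addrACA].
Qed.

Definition ideal_add I J : ideal R := Ideal (is_ideal_add I J).

End Ideals.

Definition ideal_pred (R : comNzRingType) (I : ideal R) : R -> bool :=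
  fun u => u \in (I : set R).

Lemma ideal_pred_zmod_closed (R : comNzRingType) (I : ideal R) :
  zmod_closed (ideal_pred I).
Proof.
have [I0 IP] := ideal_setP I.
split=> [|u v]; rewrite ?unfold_in /ideal_pred; first exact/mem_set.
rewrite !inE => Iu Iv.
by rewrite -mulN1r addrC; apply: IP.
Qed.

HB.instance Definition _ (R : comNzRingType) (I : ideal R) :=
  GRing.isZmodClosed.Build R (ideal_pred I) (ideal_pred_zmod_closed I).

Definition ideal_zmod (R : comNzRingType) (I : ideal R) : zmodClosed R :=
  GRing.ZmodClosed.clone R (ideal_pred I) _.

Definition quot_ring (R : comNzRingType) (I : ideal R) : Type :=
  Quotient.quot (ideal_zmod I).

Section QuotRing.
Variables (R : comNzRingType) (I : ideal R).
Local Notation Q := (quot_ring I).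

HB.instance Definition _ := Choice.on Q.
HB.instance Definition _ := GRing.Zmodule.on Q.

Definition quot_pi (u : R) : Q := \pi_(Quotient.quot (ideal_zmod I)) u.
Definition quot_repr (x : Q) : R := repr (x : Quotient.quot (ideal_zmod I)).

Lemma quot_reprK : cancel quot_repr quot_pi.
Proof. exact: reprK. Qed.

Lemma quot_piP u v : quot_pi u = quot_pi v <-> ideal_set I (u - v).
Proof.
have -> : ideal_set I (u - v) <-> is_true (ideal_pred I (u - v)).
  by rewrite /ideal_pred; split=> [/mem_set|/set_mem].
by rewrite -[ideal_pred _ _]/(_ \in ideal_pred I) Quotient.idealrBE; split=> /eqP.
Qed.

Lemma quot_pi_is_zmod_morphism : zmod_morphism quot_pi.
Proof. exact: pi_is_zmod_morphism. Qed.

HB.instance Definition _ :=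
  GRing.isZmodMorphism.Build R Q quot_pi quot_pi_is_zmod_morphism.

Definition quot_one : Q := quot_pi 1.
Definition quot_mul (x y : Q) : Q := quot_pi (quot_repr x * quot_repr y).

Lemma quot_pi_mul u v : quot_mul (quot_pi u) (quot_pi v) = quot_pi (u * v).
Proof.
have [I0 IP] := ideal_setP I.
have IM a w : ideal_set I w -> ideal_set I (a * w) by move=> Iw; rewrite -[_ * _]addr0; apply: IP.
have IR w : ideal_set I (quot_repr (quot_pi w) - w) by apply/quot_piP; rewrite quot_reprK.
apply/quot_piP; set u' := quot_repr _; set v' := quot_repr _.
have -> : u' * v' - u * v = v' * (u' - u) + u * (v' - v).
  by rewrite !mulrBr [v' * u']mulrC [v' * u]mulrC addrA subrK.
exact/IP/IM/IR/IR.
Qed.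

Lemma quot_mulA : associative quot_mul.
Proof.
move=> x y z; rewrite -[x]quot_reprK -[y]quot_reprK -[z]quot_reprK.
by rewrite !quot_pi_mul mulrA.
Qed.

Lemma quot_mulC : commutative quot_mul.
Proof. by move=> x y; rewrite /quot_mul mulrC. Qed.

Lemma quot_mul1 : left_id quot_one quot_mul.
Proof. by move=> x; rewrite -[x]quot_reprK quot_pi_mul mul1r. Qed.

Lemma quot_mulDl : left_distributive quot_mul +%R.
Proof.
move=> x y z; rewrite -[x]quot_reprK -[y]quot_reprK -[z]quot_reprK.
by rewrite -raddfD !quot_pi_mul mulrDl raddfD.
Qed.

HB.instance Definition _ := GRing.Zmodule_isComPzRing.Build Q
  quot_mulA quot_mulC quot_mul1 quot_mulDl.

Lemma quot_pi_is_monoid_morphism : monoid_morphism quot_pi.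
Proof. by split=> // u v; rewrite -[RHS]/(quot_mul _ _) quot_pi_mul. Qed.

HB.instance Definition _ :=
  GRing.isMonoidMorphism.Build R Q quot_pi quot_pi_is_monoid_morphism.

End QuotRing.

(* deg i is the homogeneous component [A]_i; the scalars of A enter only through
   its degree-one part deg 1, which contains the linear forms. *)
Definition WLP (A : comPzRingType) (deg : nat -> set A) : Prop :=
  exists2 l : A, deg 1%N l &
    forall i, set_inj (deg i) ( *%R l) \/ set_surj (deg i) (deg i.+1) ( *%R l).

Section CoverAlgebra.
Variables (K : fieldType) (n : nat) (G : sgraph n).

Definition squares_ideal : ideal {mpoly K[n]} :=
  ideal_gen [set 'X_i ^+ 2 | i in [set: 'I_n]].

Definition cover_ideal : ideal {mpoly K[n]} :=
  ideal_gen [set \prod_(i in C) 'X_i | C in vertex_cover G].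

Definition cover_algebra : comPzRingType :=
  quot_ring (ideal_add squares_ideal cover_ideal).

Definition cover_algebra_deg (i : nat) : set cover_algebra :=
  @quot_pi _ (ideal_add squares_ideal cover_ideal)
    @` [set p | p \is i.-homog].

End CoverAlgebra.

(* Main.v *)
From HB Require Import structures.
Require Import Defs.
From mathcomp Require Import all_boot all_order all_algebra.
From mathcomp Require Import boolp classical_sets functions.
From mathcomp Require Import mpoly.
From mathcomp Require Import ring zify.

(* [A]_i has as basis the squarefree monomials x_S with #|S| = i and S not a
   vertex cover, so multiplication by sum_i a_i x_i becomes the weighted up
   operator (U f)(S) = sum_(i in S) a_i f(S \ i) of the Boolean lattice, read at
   non-covers only.  For a = 1, sl2 commutation with the down operator shows that
   U is injective below the middle level and surjective above it.
   A vertex cover of C_n has at least n/2 vertices.  For n odd all sets up to the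
   middle level are therefore non-covers, and a = 1 works.  For n = 2m the only
   covers of size m are E (even vertices) and O (odd vertices), and multiplication
   [A]_(m-1) -> [A]_m fails for every l = e + o, where e and o are the parts of l
   in the variables of E and O:
   - it is not injective, as l * sum_j e^(m-1-j) (-o)^j = e^m - (-o)^m is a
     combination of x_E and x_O, hence 0 in A;
   - it is not surjective: pair off the vertices so that 0 is paired with 2; the
     product over the pairs {i, j} of (a_j x_i - a_i x_j) defines a functional that
     kills l * [A]_(m-1), and it is supported on sets containing exactly one of 0
     and 2, so that it vanishes at E and O. *)

Set Implicit Arguments.
Unset Strict Implicit.
Unset Printing Implicit Defensive.

Import GRing.Theory.

(** * The up and down operators on the Boolean lattice *)

Section BooleanLattice.
Local Open Scope ring_scope.
Variables (K : fieldType) (n : nat).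
(* K^o makes set functions a left module over K. *)
Local Notation setfun := {ffun {set 'I_n} -> K^o}.
Implicit Types (f g h : setfun) (S : {set 'I_n}) (a : 'I_n -> K).

Definition up a f : setfun := [ffun S : {set 'I_n} => \sum_(i in S) a i * f (S :\ i)].
Definition down f : setfun := [ffun S : {set 'I_n} => \sum_(i | i \notin S) f (i |: S)].

Definition on_level j f := forall S, f S != 0 -> #|S| = j.

Local Notation U := (up (fun=> 1)).

Lemma up_linear a : linear (up a).
Proof.
move=> c f g; apply/ffunP=> S; rewrite !ffunE scaler_sumr -big_split /=.
by apply: eq_bigr => i _; rewrite !ffunE mulrDr scalerAr.
Qed.
HB.instance Definition _ a := GRing.isLinear.Build K setfun setfun *:%R (up a) (up_linear a).

Lemma down_linear : linear down.
Proof.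
move=> c f g; apply/ffunP=> S; rewrite !ffunE scaler_sumr -big_split /=.
by apply: eq_bigr => i _; rewrite !ffunE.
Qed.
HB.instance Definition _ := GRing.isLinear.Build K setfun setfun *:%R down down_linear.

Lemma iter_up_linear a k : linear (iter k (up a)).
Proof. by elim: k => // k IH c f g; rewrite !iterS IH linearP. Qed.

Lemma sum_neq0 (I : finType) (P : pred I) (F : I -> K) :
  \sum_(i | P i) F i != 0 -> exists2 i, P i & F i != 0.
Proof.
move=> s0; have [/existsP[i /andP[Pi Fi]]|/existsPn F0] := boolP [exists i, P i && (F i != 0)].
  by exists i.
case/negP: s0; rewrite big1 // => i Pi; apply/eqP.
by have := F0 i; rewrite Pi negbK.
Qed.

Lemma on_level_linear j c f g : on_level j f -> on_level j g -> on_level j (c *: f + g).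
Proof.
move=> fj gj S; rewrite !ffunE; have [f0|/fj//] := eqVneq (f S) 0.
by rewrite f0 scaler0 add0r => /gj.
Qed.

Lemma up_on_level a j f : on_level j f -> on_level j.+1 (up a f).
Proof.
move=> fj S; rewrite ffunE => /sum_neq0[i iS]; rewrite mulf_eq0 negb_or => /andP[_ /fj <-].
by rewrite (cardsD1 i S) iS.
Qed.

Lemma iter_up_on_level a j k f : on_level j f -> on_level (j + k) (iter k (up a) f).
Proof. by move=> fj; elim: k => [|k IH]; rewrite ?addn0 // addnS; apply: up_on_level. Qed.

Lemma down_on_level j f : on_level j.+1 f -> on_level j (down f).
Proof.
move=> fj S; rewrite ffunE => /sum_neq0[i iS /fj].
by rewrite cardsU1 iS => -[].
Qed.

(** The terms that add [i] and remove some [j != i] are common to both composites. What remains is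
    [f S], once per [i] outside [S] in [down (U f)] and once per [j] in [S] in [U (down f)]. *)
Lemma down_up_sub f S :
  down (U f) S = U (down f) S + (n%:R - (2 * #|S|)%:R) * f S.
Proof.
have Sn : (#|S| <= n)%N by have := max_card S; rewrite card_ord.
rewrite !ffunE.
under eq_bigr => i iS do rewrite ffunE big_setU1 //= finset.setU1K // mul1r.
under [in RHS]eq_bigr => j jS do
  rewrite mul1r ffunE (bigD1 j) /= ?finset.setD1K // ?inE ?eqxx //.
rewrite !big_split /= !sumr_const exchange_big /=.
have -> : \sum_(j in S) \sum_(i | (i \notin S :\ j) && (i != j)) f (i |: S :\ j)
    = \sum_(j in S) \sum_(i | i \notin S) 1 * f ((i |: S) :\ j).
  apply: eq_bigr => j jS; apply: eq_big => [i|i].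
    by rewrite !inE; case: eqVneq => [->|]; rewrite ?jS ?andbT.
  rewrite !inE negb_and negbK => /andP[iS ij]; rewrite mul1r finset.setDUl.
  by congr (f (_ :|: _)); apply/esym/finset.setDidPl; rewrite disjoints1 inE.
have -> : #|[pred i | i \notin S]| = (n - #|S|)%N.
  rewrite -[X in (X - _)%N]card_ord -[S in RHS]finset.setCK -cardsCs.
  by apply: eq_card => i; rewrite !inE.
rewrite -[_ *+ (n - _)]mulr_natl -[_ *+ #|S|]mulr_natl (natrB _ Sn) natrM.
set x := \sum_(_ in S) _.
move: (f S : K) (x : K) (n%:R : K) (#|S|%:R : K) => fS X N s; ring.
Qed.

(** The level j - k is expressed by [#|S| + k = j] to avoid truncated subtraction for
    [iter k down f]. *)
Lemma down_up j k f : (forall S, f S != 0 -> (#|S| + k)%N = j) ->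
  down (U f) = U (down f) + (n%:R - j.*2%:R + k.*2%:R) *: f.
Proof.
move=> fj; apply/ffunP=> S; rewrite down_up_sub [RHS]ffunE; congr (_ + _); rewrite [RHS]ffunE.
have [->|/fj <-] := eqVneq (f S) 0; first by rewrite mulr0 scaler0.
by congr (_ * _); rewrite -!mul2n !natrM natrD; ring.
Qed.

Hypothesis charK : forall m, (m%:R == 0 :> K) = (m == 0)%N.

Lemma up_inj j f : (j.*2 < n)%N -> on_level j f -> U f = 0 -> f = 0.
Proof.
move=> jn fj Uf0.
(* [- c k] is the sum of the commutators n - 2j + 2i over 0 <= i < k, nonzero for k > 0 because 2j <
   n. Hence [U] undoes [down] up to a nonzero scalar on the iterates of [f], and f = 0 follows by
   descent from the first iterate that vanishes for degree reasons. *)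
pose c k : K := - (k%:R * (n%:R - j.*2%:R + k%:R - 1)).
have lev k S : iter k down f S != 0 -> (#|S| + k)%N = j.
  elim: k S => [S /fj|k IH S]; rewrite ?addn0 //= ffunE.
  by case/sum_neq0=> i iS /IH; rewrite cardsU1 iS addnS addSn.
have UD k : U (iter k.+1 down f) = c k.+1 *: iter k down f.
  elim: k => [|k IH].
    have := down_up (lev 0); rewrite /= Uf0 linear0 => /eqP.
    rewrite eq_sym addr_eq0 => /eqP ->; rewrite -scaleNr; congr (_ *: _).
    by rewrite /c double0; ring.
  have := down_up (lev k.+1); rewrite IH linearZ /= => /eqP.
  rewrite -subr_eq -scalerBl => /eqP <-; congr (_ *: _).
  by rewrite /c -!mul2n !natrM -!natr1; ring.
have g0 : iter j.+1 down f = 0.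
  by apply/ffunP=> S; rewrite [RHS]ffunE; apply/eqP/negPn/negP => /lev; lia.
suff: forall k, (k <= j.+1)%N -> iter (j.+1 - k) down f = 0.
  by move=> /(_ _ (leqnn _)); rewrite subnn.
elim=> [|k IH] kj; first by rewrite subn0.
have := UD (j - k)%N; rewrite -subSn // IH ?(ltnW kj) // linear0 => /esym/eqP.
rewrite scaler_eq0 subSS => /orP[|/eqP] //.
rewrite oppr_eq0 subSn // -natr1 addrA addrK -natrB ?(ltnW jn) //.
rewrite natr1 -natrD -natrM charK muln_eq0; lia.
Qed.

(** Moving [down] past one [U] at a time collects n - 2(j + i) for 0 <= i <= k, which add up to the
    scalar. *)
Lemma down_iter_up j k g : on_level j g ->
  down (iter k.+1 U g) =
    iter k.+1 U (down g) + (k.+1%:R * (n%:R - j.*2%:R - k%:R)) *: iter k U g.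
Proof.
move=> gj; have lev i S : iter i U g S != 0 -> (#|S| + 0)%N = (j + i)%N.
  by rewrite addn0; apply: iter_up_on_level.
elim: k => [|k IH].
  by rewrite (down_up (lev 0)) addn0; congr (_ + _ *: _); rewrite double0; ring.
rewrite (down_up (lev k.+1)) IH linearD linearZ /= -addrA -scalerDl; congr (_ + _ *: _).
by rewrite -!mul2n !natrM !natrD -!natr1; ring.
Qed.

Lemma up_surj j g : (n < j.*2)%N -> on_level j g ->
  exists2 h, on_level j.-1 h & U h = g.
Proof.
move=> jn.
(* Induction on an exponent [k] with [iter k U g = 0]; [n.+1] is one, as no set has more than n
   elements. *)
suff surj k : forall g, on_level j g -> iter k U g = 0 ->
    exists2 h, on_level j.-1 h & U h = g.
  move=> gj; apply: (surj n.+1) => //.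
  apply/ffunP=> S; rewrite [RHS]ffunE; apply/eqP/negPn/negP.
  move=> /(iter_up_on_level (a:=fun=> 1) gj).
  by have := max_card S; rewrite card_ord; lia.
have j1 : j = j.-1.+1 by lia.
elim: k => [{}g gj /= ->|k IH {}g gj Ug0].
  by exists 0; [move=> S; rewrite ffunE eqxx|rewrite linear0].
set c : K := k.+1%:R * (n%:R - j.*2%:R - k%:R).
have c0 : c != 0.
  have -> : c = - (k.+1%:R * (j.*2 - n + k)%:R) by rewrite /c natrD natrB ?(ltnW jn) //; ring.
  by rewrite oppr_eq0 -natrM charK muln_eq0; lia.
have Dlev : on_level j.-1 (down g) by apply: down_on_level; rewrite -j1.
(* [iter k U] sends this function to [down (iter k.+1 U g)], which is 0. So the function is some
   [U h], and one can solve for [g] since c != 0. *)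
have g'j : on_level j (c *: g + U (down g)).
  by apply: on_level_linear => //; rewrite [X in on_level X]j1; apply: up_on_level.
have [|h hj Uh] := IH _ g'j.
  by rewrite iter_up_linear -iterSr addrC -down_iter_up // Ug0 linear0.
(* The trailing [+ 0] gives the witness the shape required by [on_level_linear]. *)
exists (c^-1 *: (- 1 *: down g + h) + 0).
  by apply: on_level_linear; [apply: on_level_linear|move=> S; rewrite ffunE eqxx].
by rewrite addr0 linearZ linearD linearZ /= Uh scaleN1r addrC addrK scalerA mulVf // scale1r.
Qed.

End BooleanLattice.

(** * Squarefree coefficients and the cover algebra *)

Section IdealClosure.
Local Open Scope ring_scope.
Variables (R : comNzRingType).
Implicit Types (I J : ideal R) (A : set R).

Lemma ideal_gen_incl A u : A u -> ideal_set (ideal_gen A) u.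
Proof. by move=> Au I [_ AI]; apply: AI. Qed.

Lemma ideal_gen_min A I : (forall u, A u -> ideal_set I u) ->
  forall u, ideal_set (ideal_gen A) u -> ideal_set I u.
Proof. by move=> AI u; apply; split=> //; apply: ideal_setP. Qed.

Lemma idealM I a u : ideal_set I u -> ideal_set I (a * u).
Proof. by have [I0 IP] := ideal_setP I; move=> Iu; rewrite -[_ * _]addr0; apply: IP. Qed.

Lemma idealD I u v : ideal_set I u -> ideal_set I v -> ideal_set I (u + v).
Proof. by have [I0 IP] := ideal_setP I; move=> Iu; rewrite -[u]mul1r; apply: IP. Qed.

Lemma ideal_sum I (T : eqType) (r : seq T) (F : T -> R) :
  (forall t, t \in r -> ideal_set I (F t)) -> ideal_set I (\sum_(t <- r) F t).
Proof.
move=> IF; rewrite big_seq; elim/big_ind: _ => //; first by case: (ideal_setP I).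
exact: idealD.
Qed.

Lemma ideal_addl I J u : ideal_set I u -> ideal_set (ideal_add I J) u.
Proof. by move=> Iu; exists u => //; exists 0; rewrite ?addr0 //; case: (ideal_setP J). Qed.

Lemma ideal_addr I J u : ideal_set J u -> ideal_set (ideal_add I J) u.
Proof. by move=> Ju; exists 0; [case: (ideal_setP I)|exists u; rewrite ?add0r]. Qed.

End IdealClosure.

Section SquarefreeCoefficients.
Local Open Scope ring_scope.
Variables (K : fieldType) (n : nat) (G : sgraph n).
Local Notation setfun := {ffun {set 'I_n} -> K^o}.
Implicit Types (f g h : setfun) (S : {set 'I_n}) (a : 'I_n -> K) (p q : {mpoly K[n]}).

Definition sqfree_coefs p : setfun := [ffun S : {set 'I_n} => p@_(mesym1 S)].
Definition sqfree_poly f : {mpoly K[n]} := \sum_S (f S : K) *: 'X_[mesym1 S].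
Definition linear_form a : {mpoly K[n]} := \sum_i a i *: 'X_i.

Lemma sqfree_polyK : cancel sqfree_poly sqfree_coefs.
Proof.
move=> f; apply/ffunP=> S; rewrite ffunE raddf_sum /= (bigD1 S) //= big1 => [|T TS].
  by rewrite mcoeffZ mcoeffX eqxx mulr1 addr0.
by rewrite mcoeffZ mcoeffX (inj_eq (@inj_mesym1 n)) (negPf TS) mulr0.
Qed.

Lemma sqfree_poly_homog i f : on_level i f -> sqfree_poly f \is i.-homog.
Proof.
move=> fi; apply: rpred_sum => S _; have [->|/fi <-] := eqVneq (f S) 0.
  by rewrite scale0r rpred0.
by apply: rpredZ; rewrite dhomogX /= mdeg_mesym1.
Qed.

Lemma sqfree_coefs_on_level i p : p \is i.-homog -> on_level i (sqfree_coefs p).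
Proof.
move=> ph S; rewrite ffunE => pS; apply/eqP/negPn/negP => Si.
by case/eqP: pS; apply: (dhomog_nemf_coeff ph); rewrite /= mdeg_mesym1.
Qed.

Lemma sqfree_coefs_is_zmod_morphism : zmod_morphism sqfree_coefs.
Proof. by move=> p q; apply/ffunP=> S; rewrite !ffunE mcoeffB. Qed.
HB.instance Definition _ :=
  GRing.isZmodMorphism.Build _ _ sqfree_coefs sqfree_coefs_is_zmod_morphism.

(** A monomial with a square keeps it after multiplication by x_i, so the squarefree part of the
    product depends only on that of [p]. *)
Lemma sqfree_coefs_mul a p :
  sqfree_coefs (linear_form a * p) = up a (sqfree_coefs p).
Proof.
apply/ffunP=> S; rewrite !ffunE mulr_suml raddf_sum [RHS]big_mkcond /=.
apply: eq_bigr => i _; rewrite -scalerAl mcoeffZ ffunE mulrC.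
rewrite mulrC; case: ifPn => iS.
  congr (_ * _); rewrite mulrC.
  have -> : mesym1 S = (U_(i) + mesym1 (S :\ i))%MM.
    apply/mnmP=> j; rewrite mnmDE mnm1E !mnmE !inE.
    by have [<-|_] := eqVneq i j; rewrite ?iS ?eqxx // eq_sym; case: eqP.
  by rewrite mcoeffMX.
rewrite mcoeffM big1 ?mulr0 // => -[[k1 ?] [k2 ?]] /= /eqP/mnmP/(_ i) eS.
rewrite mcoeffX; case: eqP => [ek|]; last by rewrite mul0r.
by move: eS; rewrite mnmDE -ek mnm1E eqxx mnmE (negPf iS).
Qed.

Lemma homog1_linear_form p : p \is 1.-homog -> exists a, p = linear_form a.
Proof.
move=> ph; exists (fun i => p@_U_(i)); apply/mpolyP=> m.
rewrite raddf_sum /=; have [/mdeg1P[i /eqP ->]|m1] := boolP (mdeg m == 1%N).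
  rewrite (bigD1 i) //= big1 => [|j ji].
    by rewrite mcoeffZ mcoeffXU eqxx mulr1 addr0.
  by rewrite mcoeffZ mcoeffXU (negPf ji) mulr0.
rewrite (dhomog_nemf_coeff ph m1) big1 // => i _.
rewrite mcoeffZ mcoeffX; case: eqP => [e|]; last by rewrite mulr0.
by rewrite -e mdeg1 in m1.
Qed.

Lemma linear_form_homog a : linear_form a \is 1.-homog.
Proof. by apply: rpred_sum => i _; apply: rpredZ; rewrite dhomogX /= mdeg1. Qed.

Lemma vertex_cover_sub S (T : {set 'I_n}) : S \subset T -> vertex_cover G S -> vertex_cover G T.
Proof.
by move=> /fintype.subsetP ST cS i j /cS /orP[] /ST ->; rewrite ?orbT.
Qed.

Definition noncover_vanishing : set {mpoly K[n]} :=
  [set p | forall S, ~ vertex_cover G S -> sqfree_coefs p S = 0]%classic.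

(** If a product of two monomials is x_S, the second one is x_T with T inside S; subsets of
    non-covers are non-covers. *)
Lemma noncover_vanishing_is_ideal : is_ideal noncover_vanishing.
Proof.
split=> [S _|p u v Iu Iv S nS]; first by rewrite ffunE mcoeff0.
rewrite ffunE mcoeffD; have := Iv S nS; rewrite ffunE => ->; rewrite addr0.
rewrite mcoeffM big1 // => -[[k1 ?] [k2 ?]] /= /eqP/mnmP eS.
pose T : {set 'I_n} := [set i | k2 i != 0%N].
have k2E : k2 = mesym1 T.
  apply/mnmP=> i; rewrite mnmE inE.
  by have := eS i; rewrite mnmDE mnmE; case: (i \in S); case: (k2 i) => // [[|?]] //=; lia.
have TS : T \subset S.
  apply/fintype.subsetP=> i; rewrite inE; have := eS i; rewrite mnmDE mnmE.
  by case: (i \in S) => //=; lia.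
have := Iu T (fun cT => nS (vertex_cover_sub TS cT)).
by rewrite ffunE -k2E => ->; rewrite mulr0.
Qed.

(** The right-hand side defines an ideal, so one inclusion is checked on generators. Conversely,
    each monomial of [p] is divisible by some x_i^2 or is x_C for a cover C. *)
Lemma cover_algebra_idealP p :
  ideal_set (ideal_add (squares_ideal K n) (cover_ideal K G)) p <->
  forall S, ~ vertex_cover G S -> sqfree_coefs p S = 0.
Proof.
pose I := Ideal noncover_vanishing_is_ideal.
split=> [[u Ju [v Jv <-]]|p0].
  apply: (@idealD _ I).
    apply: (ideal_gen_min _ Ju) => _ [i _ <-] S _.
    rewrite ffunE mpolyXn mcoeffX; case: eqP => // /mnmP/(_ i).
    by rewrite mulmnE mnm1E eqxx mnmE; case: (i \in S).
  apply: (ideal_gen_min _ Jv) => _ [C cC <-] S nS.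
  rewrite ffunE mprodXE mcoeffX; case: eqP => // e; case: nS; suff -> : S = C by [].
  apply: inj_mesym1; rewrite -e; apply/mnmP=> i; rewrite mnm_sumE mnmE.
  under eq_bigr => j _ do rewrite mnm1E.
  have [iC|iC] := boolP (i \in C); last first.
    by rewrite big1 // => j jC; case: eqP => // ji; rewrite -ji jC in iC.
  by rewrite (bigD1 i) //= eqxx big1 // => j /andP[_ /negPf ->].
rewrite [p]mpolyE; apply: ideal_sum => m; rewrite mcoeff_msupp => pm.
rewrite -mul_mpolyC; apply: idealM.
have [/existsP[i mi]|/existsPn m1] := boolP [exists i, (1 < m i)%N].
  apply: ideal_addl; have -> : m = ((m - U_(i) *+ 2) + U_(i) *+ 2)%MM.
    rewrite submK //; apply/mnm_lepP=> j; rewrite mulmnE mnm1E.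
    by have [<-|_] := eqVneq i j; rewrite ?mul1n ?mul0n.
  rewrite mpolyXD; apply: idealM; apply: ideal_gen_incl.
  by exists i => //; rewrite mpolyXn.
apply: ideal_addr; pose C : {set 'I_n} := [set i | m i != 0%N].
have mE : m = mesym1 C.
  by apply/mnmP=> i; rewrite mnmE inE; have := m1 i; case: (m i) => [|[|]].
apply: ideal_gen_incl; exists C.
  by apply: contrapT => /p0; rewrite ffunE -mE; apply/eqP.
rewrite mpolyXE_id [LHS]big_mkcond; apply: eq_bigr => i _.
by rewrite mE mnmE; case: (i \in C).
Qed.

End SquarefreeCoefficients.

(** * The WLP in terms of the up operator *)

Section Combinatorial.
Local Open Scope ring_scope.
Variables (K : fieldType) (n : nat) (G : sgraph n).
Local Notation setfun := {ffun {set 'I_n} -> K^o}.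

Definition inj_up a i := forall f : setfun, on_level i f ->
  (forall S, ~ vertex_cover G S -> up a f S = 0) ->
  forall S, ~ vertex_cover G S -> f S = 0.

Definition surj_up a i := forall g : setfun, on_level i.+1 g ->
  exists2 f : setfun, on_level i f & forall S, ~ vertex_cover G S -> up a f S = g S.

Local Notation I := (ideal_add (squares_ideal K n) (cover_ideal K G)).

Lemma inj_upP a i :
  set_inj (@cover_algebra_deg K n G i) ( *%R (quot_pi I (linear_form a))) <-> inj_up a i.
Proof.
split=> [linj f fi Uf|finj _ _ /set_mem[p ph <-] /set_mem[q qh <-]].
  have /quot_piP/cover_algebra_idealP : quot_pi I (sqfree_poly f) = quot_pi I 0.
    apply: linj; try apply/mem_set.
    - by exists (sqfree_poly f) => //=; apply: sqfree_poly_homog.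
    - by exists 0 => //=; apply: rpred0.
    rewrite -!rmorphM /= mulr0; apply/quot_piP/cover_algebra_idealP => S nS.
    by rewrite subr0 sqfree_coefs_mul sqfree_polyK Uf.
  by rewrite subr0 sqfree_polyK.
rewrite -!rmorphM /= => /quot_piP/cover_algebra_idealP pq.
apply/quot_piP/cover_algebra_idealP; apply: finj.
  by apply: sqfree_coefs_on_level; apply: rpredB.
by move=> S /pq; rewrite -mulrBr sqfree_coefs_mul.
Qed.

Lemma surj_upP a i :
  set_surj (@cover_algebra_deg K n G i) (@cover_algebra_deg K n G i.+1)
    ( *%R (quot_pi I (linear_form a))) <-> surj_up a i.
Proof.
split=> [lsurj g gi|fsurj _ [q qh <-]].
  have [|_ [p ph <-]] := lsurj (quot_pi I (sqfree_poly g)).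
    by exists (sqfree_poly g) => //=; apply: sqfree_poly_homog.
  rewrite -!rmorphM /= => /quot_piP/cover_algebra_idealP pq.
  exists (sqfree_coefs p); first exact: sqfree_coefs_on_level.
  move=> S /pq; rewrite raddfB /= sqfree_coefs_mul sqfree_polyK !ffunE.
  by move/eqP; rewrite subr_eq0 => /eqP.
have [f fi Uf] := fsurj _ (sqfree_coefs_on_level qh).
exists (quot_pi I (sqfree_poly f)).
  by exists (sqfree_poly f) => //=; apply: sqfree_poly_homog.
rewrite -!rmorphM /=; apply/quot_piP/cover_algebra_idealP => S /Uf UfS.
by rewrite raddfB /= sqfree_coefs_mul sqfree_polyK [LHS]ffunE [X in _ + X]ffunE UfS subrr.
Qed.

Lemma WLP_upP :
  WLP (@cover_algebra_deg K n G) <-> exists a, forall i, inj_up a i \/ surj_up a i.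
Proof.
split=> [[_ [p ph <-] Wp]|[a Wa]].
  have [a pE] := homog1_linear_form ph; exists a => i.
  by have := Wp i; rewrite pE => -[/inj_upP|/surj_upP]; [left|right].
exists (quot_pi I (linear_form a)).
  by exists (linear_form a) => //=; apply: linear_form_homog.
by move=> i; case: (Wa i) => [/inj_upP|/surj_upP]; [left|right].
Qed.

End Combinatorial.

(** * Vertex covers of cycles *)

Section CycleCovers.
Variable n : nat.
Implicit Types (S C : {set 'I_n}).

Lemma card_preim_inj (s : 'I_n -> 'I_n) S : injective s -> \sum_i (s i \in S : nat) = #|S|.
Proof.
move=> sI; rewrite -sum1_card [RHS]big_mkcond [RHS](reindex_inj sI) /=.
by apply: eq_bigr => i _; case: (_ \in _).
Qed.

Lemma card_flipped (s : 'I_n -> 'I_n) S :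
  injective s -> (forall i, (s i \in S) = (i \notin S)) -> #|S|.*2 = n.
Proof.
move=> sI sS; rewrite -addnn -{1}(card_preim_inj S sI) -(card_preim_inj S (@inj_id _)).
rewrite -big_split /= -[RHS]card_ord -sum1_card.
by apply: eq_bigr => i _; rewrite sS; case: (i \in S).
Qed.

Lemma cycle_adj_ordS (i : 'I_n) : 1 < n -> cycle_adj i (ordS i).
Proof.
move=> n1; rewrite /cycle_adj /= eqxx andbT; apply/eqP=> /(congr1 val) /=.
have := ltn_ord i; rewrite leq_eqVlt => /orP[/eqP ni|lt]; last by rewrite modn_small //; lia.
by rewrite ni modnn; lia.
Qed.

Lemma cycle_cover_edge C (i : 'I_n) : 1 < n -> vertex_cover (cycle_graph n) C ->
  (i \in C) || (ordS i \in C).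
Proof. by move=> n1; apply; apply: cycle_adj_ordS. Qed.

Lemma sum_cycle_edges C : \sum_i ((i \in C) + (ordS i \in C)) = #|C|.*2.
Proof.
rewrite big_split /= (card_preim_inj _ (@ordS_inj n)) -addnn; congr (_ + _).
by rewrite -sum1_card [RHS]big_mkcond.
Qed.

Lemma card_cycle_cover C : 1 < n -> vertex_cover (cycle_graph n) C -> n <= #|C|.*2.
Proof.
move=> n1 cC; rewrite -sum_cycle_edges -[X in X <= _]card_ord -sum1_card.
by apply: leq_sum => i _; have := cycle_cover_edge i n1 cC; do 2!case: (_ \in C).
Qed.

(** Equality case of [card_cycle_cover]: the n summands of [sum_cycle_edges] are all at least 1 and
    add up to n, so each is 1. *)
Lemma cycle_cover_alternates C (i : 'I_n) : 1 < n -> vertex_cover (cycle_graph n) C ->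
  #|C|.*2 = n -> (ordS i \in C) = (i \notin C).
Proof.
move=> n1 cC Cn; have := cycle_cover_edge i n1 cC.
suff: (i \in C) + (ordS i \in C) == 1 by do 2!case: (_ \in C).
have : \sum_(j < n) 1 == \sum_j ((j \in C) + (ordS j \in C)).
  by rewrite sum_cycle_edges sum1_card card_ord Cn.
have leE j : true -> 1 <= (j \in C) + (ordS j \in C) ?= iff (1 == (j \in C) + (ordS j \in C)).
  by move=> _; split=> //; have := cycle_cover_edge j n1 cC; do 2!case: (_ \in C).
by rewrite (leqif_sum leE).2 => /fintype.forallP/(_ i) /=; rewrite eq_sym.
Qed.

Lemma odd_ordS (i : 'I_n) : ~~ odd n -> odd (ordS i) = ~~ odd i.
Proof.
move=> nev /=; have := ltn_ord i; rewrite leq_eqVlt => /orP[/eqP ni|lt].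
  by have := congr1 odd ni; rewrite /= (negPf nev) => ->; rewrite ni modnn.
by rewrite modn_small.
Qed.

Lemma card_parity_class b : ~~ odd n -> #|[set i : 'I_n | odd i == b]|.*2 = n.
Proof.
move=> nev; apply: (card_flipped (@ordS_inj n)) => i.
by rewrite !inE odd_ordS //; case: (odd i) b => [] [].
Qed.

Lemma parity_class_cover b C : ~~ odd n -> {in C, forall i : 'I_n, odd i = b} -> #|C|.*2 = n ->
  vertex_cover (cycle_graph n) C.
Proof.
move=> nev Cb Cn.
have {Cn}-> : C = [set i : 'I_n | odd i == b].
  apply/eqP; rewrite eqEcard; apply/andP; split.
    by apply/fintype.subsetP=> i /Cb; rewrite inE => ->.
  by rewrite -leq_double card_parity_class ?Cn.
by move=> i j /andP[_ /orP[] /eqP ->]; rewrite !inE odd_ordS //; do 2!case: odd; case: b {Cb}.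
Qed.

End CycleCovers.

Lemma subset_of_card (T : finType) (A : {set T}) k :
  k <= #|A| -> exists2 B : {set T}, B \subset A & #|B| = k.
Proof.
elim: k => [|k IH] kA; first by exists finset.set0; rewrite ?finset.sub0set ?cards0.
have [B BA Bk] := IH (ltnW kA).
have /fintype.properP[_ [x xA xB]] : B \proper A by rewrite properEcard BA Bk.
by exists (x |: B); rewrite ?finset.subUset ?finset.sub1set ?xA // cardsU1 xB Bk.
Qed.

(** * Odd cycles *)

Section Odd.
Local Open Scope ring_scope.
Variables (K : fieldType) (n : nat).
Hypothesis charK : forall m, (m%:R == 0 :> K) = (m == 0)%N.

Lemma odd_cycle_up i : (2 < n)%N -> odd n ->
  inj_up (cycle_graph n) (fun=> 1 : K) i \/ surj_up (cycle_graph n) (fun=> 1 : K) i.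
Proof.
(* If 2(i + 1) < n, the target level contains no cover, so [U f] vanishes everywhere. Otherwise 2(i
   + 1) > n by oddness. *)
move=> n3 nodd; have [lt|ge] := ltnP i.+1.*2 n.
  left=> f fi Uf S _; suff -> : f = 0 by rewrite ffunE.
  apply: (up_inj charK _ fi); first lia.
  apply/ffunP=> T; rewrite [RHS]ffunE; apply/eqP/negPn/negP => UfT.
  have Ti := up_on_level fi UfT; case/eqP: UfT; apply: Uf => cT.
  by have := card_cycle_cover (ltnW n3) cT; rewrite Ti leqNgt lt.
right=> g gi; have [|f fi Uf] := up_surj charK _ gi; last by exists f => // S _; rewrite Uf.
by rewrite ltn_neqAle ge andbT; apply: contraTneq nodd => ->; rewrite odd_double.
Qed.

End Odd.

(** * Even cycles *)

Section Even.
Local Open Scope ring_scope.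
Variables (K : fieldType) (m : nat).
Hypothesis charK : forall m, (m%:R == 0 :> K) = (m == 0)%N.
Local Notation n := m.*2.
Local Notation setfun := {ffun {set 'I_n} -> K^o}.
Hypothesis m_gt1 : (1 < m)%N.
Variable a : 'I_n -> K.

Local Notation ev S := (#|[set i in S | ~~ odd i]|).
Local Notation od S := (#|[set i in S | odd i]|).

(* Coefficients of sum_j e^(m-1-j) (-o)^j. *)
Definition alternating : setfun :=
  [ffun S : {set 'I_n} => if #|S| == m.-1 then
     (-1) ^+ od S * ((ev S)`! * (od S)`!)%:R * \prod_(i in S) a i else 0].

Lemma parity_setD1 (S : {set 'I_n}) i : i \in S ->
  ev S = (~~ odd i + ev (S :\ i))%N /\ od S = (odd i + od (S :\ i))%N.
Proof.
move=> iS; split.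
  rewrite (cardsD1 i [set j in S | _]) !inE iS; congr (_ + _)%N.
  by apply: eq_card => j; rewrite !inE andbA.
rewrite (cardsD1 i [set j in S | _]) !inE iS; congr (_ + _)%N.
by apply: eq_card => j; rewrite !inE andbA.
Qed.

(** The factorials come from the squarefree parts of the powers of e and o. With [c] the formula of
    [alternating] extended to a set of size m, the even elements of [S] contribute [c] in total and
    the odd ones [- c]. *)
Lemma up_alternating (S : {set 'I_n}) :
  ~ vertex_cover (cycle_graph n) S -> up a alternating S = 0.
Proof.
move=> nS; rewrite ffunE; have [Sm|Sm] := eqVneq #|S| m; last first.
  apply: big1 => i iS; rewrite ffunE; case: eqP => [e|_]; last by rewrite mulr0.
  by move: Sm; rewrite (cardsD1 i S) iS e add1n prednK ?eqxx //; lia.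
pose c : K := (-1) ^+ od S * ((ev S)`! * (od S)`!)%:R * \prod_(i in S) a i.
(* A set of size m inside one parity class would be a cover. So [S] meets both classes, and the
   divisors below are nonzero. *)
have evod b : exists2 i, i \in S & odd i = b.
  have [/existsP[i /andP[iS /eqP ib]]|/existsPn noi] :=
    boolP [exists i, (i \in S) && (odd i == b)].
    by exists i.
  case: nS; apply: (@parity_class_cover _ (~~ b)); rewrite ?odd_double ?Sm // => i iS.
  by have := noi i; rewrite iS /=; case: (odd i) b {noi} => [] [].
have evS : (0 < ev S)%N.
  by have [i iS io] := evod false; apply/card_gt0P; exists i; rewrite inE iS io.
have odS : (0 < od S)%N.
  by have [i iS io] := evod true; apply/card_gt0P; exists i; rewrite inE iS io.
have evK : (ev S)%:R != 0 :> K by rewrite charK -lt0n.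
have odK : (od S)%:R != 0 :> K by rewrite charK -lt0n.
have term i : i \in S -> a i * alternating (S :\ i) =
    if odd i then - c / (od S)%:R else c / (ev S)%:R.
  move=> iS; have [] := parity_setD1 iS.
  have -> : alternating (S :\ i) = (-1) ^+ od (S :\ i) *
      ((ev (S :\ i))`! * (od (S :\ i))`!)%:R * \prod_(j in S :\ i) a j.
    by rewrite ffunE (_ : #|S :\ i| = m.-1) ?eqxx //; have := cardsD1 i S; rewrite iS Sm; lia.
  rewrite /c (big_setD1 i iS) /=.
  case: ifP => io /= eS oS.
    apply: (canRL (mulfK odK)); rewrite oS eS add0n add1n factS exprS !natrM; ring.
  apply: (canRL (mulfK evK)); rewrite oS eS add0n add1n factS !natrM; ring.
rewrite (eq_bigr _ term) (bigID (fun i : 'I_n => odd i)) /=.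
rewrite (eq_bigr (fun=> - c / (od S)%:R)) => [|i /andP[_ ->]] //.
rewrite [X in _ + X](eq_bigr (fun=> c / (ev S)%:R)) => [|i /andP[_ /negPf ->]] //.
rewrite !sumr_const.
have -> : #|[pred i | (i \in S) && odd i]| = od S by apply: eq_card => i; rewrite !inE.
have -> : #|[pred i | (i \in S) && ~~ odd i]| = ev S by apply: eq_card => i; rewrite !inE.
by rewrite -[_ *+ od S]mulr_natr -[_ *+ ev S]mulr_natr !mulfVK // addNr.
Qed.

Lemma not_inj_up : ~ inj_up (cycle_graph n) a m.-1.
Proof.
move=> inj.
have ncov (S : {set 'I_n}) : #|S| = m.-1 -> ~ vertex_cover (cycle_graph n) S.
  move=> Sm /card_cycle_cover; rewrite Sm; lia.
pose A := [set i | a i != 0].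
(* The alternating function vanishes if fewer than m - 1 of the a_i are nonzero;
   then l kills any monomial of degree m - 1 divisible by the x_i with a_i != 0. *)
have [le|/ltnW le] := leqP m.-1 #|A|.
  have [S SA Sm] := subset_of_card le.
  have /(inj alternating)/(_ up_alternating)/(_ S (ncov _ Sm)) : on_level m.-1 alternating.
    by move=> T; rewrite ffunE; case: (#|T| =P m.-1); rewrite ?eqxx.
  rewrite ffunE Sm eqxx => /eqP.
  rewrite !mulf_eq0 signr_eq0 charK muln_eq0 !gtn_eqF ?fact_gt0 //= => /prodf_eq0[i iS].
  by have /fintype.subsetP/(_ i iS) := SA; rewrite inE => /negPf ->.
(* [~: B] contains [A] and has m - 1 elements: it is the support of the monomial. *)
have [|B BA Bm] := @subset_of_card _ (~: A) (n - m.-1).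
  by rewrite -(leq_add2l #|A|) cardsC card_ord; lia.
have Sm : #|~: B| = m.-1 by have := cardsC B; rewrite card_ord Bm; lia.
pose f : setfun := [ffun S : {set 'I_n} => (S == ~: B)%:R].
have flev : on_level m.-1 f.
  by move=> T; rewrite ffunE; case: (T =P ~: B) => [->|]; rewrite ?eqxx.
suff /eqP : f (~: B) = 0 by rewrite ffunE eqxx oner_eq0.
apply: (inj f flev) (ncov _ Sm) => S _.
rewrite ffunE big1 // => i iS; rewrite ffunE; case: eqP => [e|]; last by rewrite mulr0.
suff -> : a i = 0 by rewrite mul0r.
have iB : i \in B by have := finset.setD11 i S; rewrite e inE => /negbFE.
by have /fintype.subsetP/(_ i iB) := BA; rewrite !inE negbK => /eqP.
Qed.

(** * Failure of surjectivity: the functional attached to a pairing *)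

Section Transversal.
Variable s : 'I_n -> 'I_n.
Hypotheses (sK : involutive s) (s_neq : forall i, s i != i).

(* Any nonzero weights orthogonal to (a_i, a_(s i)) on each pair will do. *)
Definition pair_weight i : K :=
  if (a i == 0) && (a (s i) == 0) then 1 else
  if (i < s i)%N then a (s i) else - a (s i).

Definition transversal (S : {set 'I_n}) := [forall i, (s i \in S) == (i \notin S)].

(** The coefficients of the product over all pairs of the forms [pair_weight i] x_i +
    [pair_weight (s i)] x_(s i). *)
Definition transversal_weight (S : {set 'I_n}) : K :=
  if transversal S then \prod_(i in S) pair_weight i else 0.

Lemma pair_weight_cancel i : a i * pair_weight i + a (s i) * pair_weight (s i) = 0.
Proof.
rewrite /pair_weight sK andbC; case: andP => [[/eqP -> /eqP ->]|_]; first by rewrite !mul0r addr0.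
case: ltngtP => [_|_|/val_inj e]; [ring|ring|].
by have := s_neq i; rewrite -e eqxx.
Qed.

Lemma transversal_exchange (T : {set 'I_n}) i : i \notin T -> s i \notin T ->
  transversal (i |: T) -> transversal (s i |: T).
Proof.
move=> iT siT /forallP tr; apply/forallP=> j; have := tr j.
rewrite !inE (inj_eq (inv_inj sK)) (can2_eq sK sK).
have si := negPf (s_neq i); have is_ : (i == s i) = false by rewrite eq_sym.
have [->|ji] := eqVneq j i; first by rewrite is_ (negPf iT) (negPf siT).
by have [->|jsi] := eqVneq j (s i); rewrite ?sK ?(negPf iT) ?(negPf siT).
Qed.

(** This is the vanishing of the functional on l * x_T. If [T] meets {i, s i}, neither index
    contributes. Otherwise adding [i] or [s i] gives two transversals, whose terms cancel, or
    none. *)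
Lemma transversal_weight_orth (T : {set 'I_n}) :
  \sum_(i | i \notin T) a i * transversal_weight (i |: T) = 0.
Proof.
rewrite big_mkcond; pose F i : K := if i \notin T then a i * transversal_weight (i |: T) else 0.
have F_cancel i : F i + F (s i) = 0.
  rewrite /F; have [iT|iT] := boolP (i \in T); have [siT|siT] := boolP (s i \in T);
    rewrite /= ?add0r ?addr0 //.
  - rewrite /transversal_weight ifN ?mulr0 //; apply/forallP=> /(_ i).
    by rewrite !inE eqxx iT orbT.
  - rewrite /transversal_weight ifN ?mulr0 //; apply/forallP=> /(_ i).
    by rewrite !inE eqxx siT orbT.
  rewrite /transversal_weight.
  have -> : transversal (s i |: T) = transversal (i |: T).
    apply/idP/idP; last exact: transversal_exchange.
    by have := @transversal_exchange T (s i) siT; rewrite sK; apply.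
  case: ifP => _; last by rewrite !mulr0 addr0.
  by rewrite !big_setU1 //= !mulrA -mulrDl pair_weight_cancel mul0r.
(* Each pair is counted twice; characteristic 0 removes the factor 2. *)
have /eqP : \sum_i F i + \sum_i F i = 0.
  by rewrite [X in _ + X](reindex_inj (inv_inj sK)) -big_split big1 //= => i _.
by rewrite -mulr2n -mulr_natl mulf_eq0 charK => /eqP.
Qed.

Lemma transversal_weight_neq0 : exists S, transversal_weight S != 0.
Proof.
pose u := pair_weight.
have u_neq0 i : u i == 0 -> u (s i) != 0.
  rewrite /u /pair_weight sK.
  have [ai|ai] := eqVneq (a i) 0; have [asi|asi] := eqVneq (a (s i)) 0; rewrite ?oner_eq0 //=.
  - by case: ifP => _; rewrite ?oppr_eq0 (negPf asi).
  - by move=> _; case: ifP => _; rewrite ?oppr_eq0.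
  - by case: ifP => _; rewrite ?oppr_eq0 (negPf asi).
(* From each pair, the only element of nonzero weight, or the smaller one if both weights are
   nonzero. *)
exists [set i | (u i != 0) && ((u (s i) == 0) || (i < s i)%N)].
rewrite /transversal_weight ifT; last first.
  apply/forallP=> i; rewrite !inE sK.
  have [ui|ui] := boolP (u i == 0); first by rewrite u_neq0.
  rewrite /=; have [//|usi] := boolP (u (s i) == 0).
  by have := s_neq i; rewrite -val_eqE /=; lia.
by apply/prodf_neq0 => i; rewrite inE => /andP[].
Qed.

(** A monomial x_S0 of nonzero weight is not in the image. The values of [up a f] at covers are not
    controlled, but covers have weight 0 by the hypothesis. *)
Lemma not_surj_up :
  (forall S, transversal S -> ~ vertex_cover (cycle_graph n) S) ->
  ~ surj_up (cycle_graph n) a m.-1.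
Proof.
move=> trcov; have [S0 gS0] := transversal_weight_neq0.
have S0tr : transversal S0 by move: gS0; rewrite /transversal_weight; case: ifP; rewrite ?eqxx.
have S0m : #|S0| = m.-1.+1.
  have := card_flipped (inv_inj sK) (fun i => eqP (forallP S0tr i)); lia.
pose g : setfun := [ffun S : {set 'I_n} => (S == S0)%:R].
case/(_ g) => [S|f _ Uf]; first by rewrite ffunE; case: (S =P S0) => [->|]; rewrite ?eqxx.
have : \sum_S transversal_weight S * up a f S = transversal_weight S0.
  rewrite (bigD1 S0) //= big1 => [|S SS0].
    by rewrite Uf ?ffunE ?eqxx ?mulr1 ?addr0 //; apply: trcov.
  rewrite /transversal_weight; case: ifP => [/trcov Scov|]; last by rewrite mul0r.
  by rewrite Uf // ffunE (negPf SS0) mulr0.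
suff -> : \sum_S transversal_weight S * up a f S = 0 by move=> e; rewrite -e eqxx in gS0.
(* Passage to the adjoint of [up a]: pairs of [S] and [i \in S] correspond to pairs of T = [S :\ i]
   and [i \notin T]. *)
transitivity (\sum_(T : {set 'I_n}) \sum_(i | i \notin T)
    f T * (a i * transversal_weight (i |: T))).
  under eq_bigr => S _ do rewrite ffunE mulr_sumr big_mkcond.
  under [RHS]eq_bigr => S _ do rewrite big_mkcond.
  rewrite exchange_big [RHS]exchange_big /=; apply: eq_bigr => i _.
  rewrite -!big_mkcond /= (reindex_onto (fun T => i |: T) (fun S => S :\ i)) /=; last first.
    by move=> S iS; rewrite finset.setD1K.
  apply: eq_big => [T|T /andP[_ /eqP e]].
    rewrite finset.setU11 /=; apply/eqP/idP => [<-|iT]; first by rewrite finset.setD11.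
    by rewrite finset.setU1K.
  by rewrite e; ring.
by apply: big1 => T _; rewrite -mulr_sumr transversal_weight_orth mulr0.
Qed.

End Transversal.

(* The pairs {0, 2}, {1, 3}, {4, 5}, {6, 7}, ... *)
Definition swap_nat (i : nat) : nat :=
  (if i < 2 then i + 2 else if i < 4 then i - 2 else if odd i then i.-1 else i.+1)%N.

(** The default value of [insubd] is never taken: n is even and at least 4, so [swap_nat] preserves
    the numbers below n. *)
Definition swap_ord (i : 'I_n) : 'I_n := insubd i (swap_nat i).

Lemma swap_natK : involutive swap_nat.
Proof.
move=> i; rewrite {2}/swap_nat; case: ifP => ?; last case: ifP => ?; last case: ifP => ?;
  by rewrite /swap_nat; do ?[case: ifP => ?]; lia.
Qed.

Lemma swap_ordE i : swap_ord i = swap_nat i :> nat.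
Proof.
rewrite /swap_ord val_insubd ifT // /swap_nat; have := ltn_ord i.
by do ?[case: ifP => ?]; lia.
Qed.

Lemma swap_ordK : involutive swap_ord.
Proof. by move=> i; apply: val_inj; rewrite /= !swap_ordE swap_natK. Qed.

Lemma swap_ord_neq i : swap_ord i != i.
Proof. by rewrite -val_eqE /= swap_ordE /swap_nat; do ?[case: ifP => ?]; lia. Qed.

(** A transversal has m elements, so as a cover it would alternate along the cycle and contain both
    or neither of 0 and 2. *)
Lemma swap_transversal_not_cover S :
  transversal swap_ord S -> ~ vertex_cover (cycle_graph n) S.
Proof.
move=> /forallP tr cS.
have Sn := card_flipped (inv_inj swap_ordK) (fun i => eqP (tr i)).
have n0 : (0 < n)%N by lia.
pose i := Ordinal n0; have n1 : (1 < n)%N by lia.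
have /eqP := tr i.
have -> : swap_ord i = ordS (ordS i).
  by apply: val_inj; rewrite /= swap_ordE !modn_small //; lia.
by rewrite !cycle_cover_alternates // negbK; case: (i \in S).
Qed.

End Even.

Theorem theorem5p2 (K : fieldType) (K_char0 : [pchar K]%R =i pred0)
    (n : nat) (n_ge3 : 3 <= n) :
  WLP (@cover_algebra_deg K n (cycle_graph n)) <-> odd n.
Proof.
have charK := (pcharf0P K).1 K_char0.
split=> [/WLP_upP[a Wa]|nodd]; last first.
  by apply/WLP_upP; exists (fun=> 1%R) => i; apply: odd_cycle_up.
apply: contraT => nev; have nE : n = n./2.*2 by rewrite even_halfK.
(* With n = 2m, the bound n >= 3 gives m >= 2; both properties fail in degree m - 1. *)
have m1 : 1 < n./2 by lia.
move: a Wa; rewrite nE => a /(_ n./2.-1) [|].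
  by move/(not_inj_up charK m1).
by move/(not_surj_up charK m1 (swap_ordK m1) (swap_ord_neq m1) (swap_transversal_not_cover m1)).
Qed.
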